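(* Let $\Omega$ be a finite set (of columns) and let $(A_B)_{B\in\mathcal B}$ be a finite indexed family of subsets of $\Omega$ (supports), each with $|A_B|\ge2$. Suppose that every column $\lambda\in\Omega$ belongs to at least one support $A_B$. Then for every $B\in\mathcal B$ there are three subsets $J_B^0,J_B^1,J_B^*\subseteq A_B$, each of size $\lfloor |A_B|/2\rfloor$, such that for every $\lambda\in\Omega$ the integer $$D_\lambda=\sum_{B\in\mathcal B}\bigl(\mathbf 1_{\{\lambda\in J_B^0\}}+\mathbf 1_{\{\lambda\in J_B^1\}}-2\,\mathbf 1_{\{\lambda\in J_B^*\}}\bigr)$$ satisfies $D_\lambda\in\{-2,-1,1,2\}$. Moreover the bound $|D_\lambda|\le 2$ is best possible if zero values are forbidden: there exist such data $(\Omega,(A_B)_{B\in\mathcal B})$ for which no choice of subsets $J_B^0,J_B^1,J_B^*\subseteq A_B$ of size $\lfloor|A_B|/2\rfloor$ makes $D_\lambda\in\{-1,1\}$ for all $\lambda\in\Omega$.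
   Context: The family is indexed, so the same subset of $\Omega$ may occur for several indices $B$. $\mathbf 1_{\{\cdot\}}$ denotes the $0/1$ indicator; $D_\lambda$ is regarded as an integer. *)

(* Defs.v *)
From mathcomp Require Import all_boot all_order all_algebra.

Set Implicit Arguments.
Unset Strict Implicit.
Unset Printing Implicit Defensive.

Local Open Scope ring_scope.

Section Supports.

(* The finite set of columns is the whole finType Omega; the supports are
   indexed by a finType I, so the same subset may occur at several indices. *)
Variables (Omega I : finType).
Implicit Types A J : I -> {set Omega}.

Definition support_family A : Prop :=
  (forall B : I, (2 <= #|A B|)%N) /\
  (forall l : Omega, exists B : I, l \in A B).

Definition half_choice A J : Prop :=
  forall B : I, J B \subset A B /\ #|J B| = (#|A B| %/ 2)%N.

Definition indicator (J : {set Omega}) (l : Omega) : int := (l \in J)%:R.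

Definition discrepancy (J0 J1 Js : I -> {set Omega}) (l : Omega) : int :=
  \sum_(B : I) (indicator (J0 B) l + indicator (J1 B) l
                - 2 * indicator (Js B) l).

End Supports.

(* Main.v *)
Require Import Defs.
From mathcomp Require Import all_boot all_order all_algebra.
From mathcomp Require Import zify.

Set Implicit Arguments.
Unset Strict Implicit.
Unset Printing Implicit Defensive.

Import GRing.Theory.

(** The supports are treated one after another.  Write the contribution of a
    single support [A] to [D_l] as [1_X + 1_Y - 2 1_W] with [X], [Y], [W] of
    size [|A|/2]; its sum over all columns is [0].  The running sums are kept
    within [-2, 2], and once a support has been treated all its columns have,
    for ever after, a nonzero running sum.  When [A] is reached, let [S] be the
    set of its columns whose running sum is still [0].
    - If [S] is empty, equal sets [X = Y = W] change nothing.
    - If [S] has at least two columns, the contribution can be made nonzero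
      exactly on [S] ([spread_contribution]): pair off [S] with values [+1] and
      [-1], and, when [|S|] is odd, use [-2, 1, 1] on the last three columns.
    - If [S] is a single column [x], pick another column [y] of [A].  Its running
      sum [v] is one of [-2, -1, 1, 2], so one of [v + 1], [v - 1] is again in
      this list; add that unit to [y] and its opposite to [x]
      ([transfer_contribution]).

    After the last support every column has a nonzero running sum, because
    the supports cover all columns.

    The values [-1] and [1] do not suffice, since the [D_l] always sum to [0],
    which is impossible for an odd number of odd integers; a single support
    of three columns is an instance. *)

(** * Choosing the three sets in one support *)

Lemma subset_of_card (T : finType) (k : nat) (A : {set T}) :
  (k <= #|A|)%N -> exists2 B : {set T}, B \subset A & #|B| = k.
Proof.
move=> leq_kA; exists [set x in take k (enum A)].
  by apply/subsetP => x; rewrite inE => /mem_take; rewrite mem_enum.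
rewrite cardsE (card_uniqP _) ?take_uniq ?enum_uniq //.
by rewrite size_takel // -cardE.
Qed.

Local Open Scope ring_scope.

Definition contribution (T : finType) (X Y W : {set T}) (l : T) : int :=
  indicator X l + indicator Y l - 2 * indicator W l.

Definition half_subset (T : finType) (A J : {set T}) : Prop :=
  J \subset A /\ #|J| = (#|A| %/ 2)%N.

Lemma contribution_bounded (T : finType) (X Y W : {set T}) (l : T) :
  -2 <= contribution X Y W l <= 2.
Proof.
by rewrite /contribution /indicator; case: (l \in X) (l \in Y) (l \in W) => [] [] [].
Qed.

(** Small sets inside [S] extend to sets of the prescribed size by adding the
    same padding outside [S] to all three, which cancels in the contribution.
    The bounds on [|S|] give [j <= |A|/2] and leave enough room in [A :\: S]. *)
Lemma pad_contribution (T : finType) (A S X Y W : {set T}) (j : nat) :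
    S \subset A -> X \subset S -> Y \subset S -> W \subset S ->
    #|X| = j -> #|Y| = j -> #|W| = j -> (j.*2 <= #|S| <= j.*2.+1)%N ->
  exists X' Y' W' : {set T},
    [/\ half_subset A X', half_subset A Y', half_subset A W' &
        contribution X' Y' W' =1 contribution X Y W].
Proof.
move=> sSA sXS sYS sWS cX cY cW cS.
have cA := cardsID S A; rewrite (setIidPr sSA) in cA.
have [|C sC cC] := @subset_of_card T (#|A| %/ 2 - j) (A :\: S); first by lia.
have pad (J : {set T}) : J \subset S -> #|J| = j -> half_subset A (J :|: C).
  move=> sJS cJ; split.
    rewrite subUset (subset_trans sJS sSA).
    exact: subset_trans sC (subsetDl _ _).
  have /disjoint_setI0 JC0 : [disjoint J & C].
    rewrite disjoints_subset; apply/subsetP => x /(subsetP sJS) xS.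
    by rewrite inE; apply: contraL xS => /(subsetP sC); rewrite inE => /andP[].
  by rewrite cardsU JC0 cards0 cJ cC; lia.
exists (X :|: C), (Y :|: C), (W :|: C); split; try exact: pad.
move=> l; rewrite /contribution /indicator !inE.
have [lC|_] := boolP (l \in C); last by rewrite !orbF.
have /negbTE lS : l \notin S by move/(subsetP sC): lC; rewrite inE => /andP[].
have notin (J : {set T}) : J \subset S -> l \in J = false.
  by move=> sJS; apply: contraFF lS => /(subsetP sJS).
by rewrite !notin.
Qed.

(** The contribution is [1 - 2 1_W], hence odd, at the columns of [S] covered by
    the disjoint sets [X] and [Y], and it is [-2] at a column of [S] that they
    miss, provided that this column is in [W].  The case [|S| = 1] is
    impossible, because the contributions sum to [0]. *)
Lemma spread_contribution (T : finType) (A S : {set T}) :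
    S \subset A -> #|S| != 1%N ->
  exists X Y W : {set T},
    [/\ half_subset A X, half_subset A Y, half_subset A W &
        forall l, (contribution X Y W l != 0) = (l \in S)].
Proof.
move=> sSA cS; pose j := (#|S| %/ 2)%N.
have [|X sXS cX] := @subset_of_card T j S; first by lia.
have cSX := cardsID X S; rewrite (setIidPr sXS) in cSX.
have [|Y sYSX cY] := @subset_of_card T j (S :\: X); first by lia.
(* [Z] consists of the column left over when |S| is odd; [V :|: Z] is [W]. *)
pose Z := S :\: X :\: Y.
have cZ := cardsID Y (S :\: X); rewrite (setIidPr sYSX) -/Z in cZ.
have [|V sVX cV] := @subset_of_card T (j - #|Z|) X; first by lia.
have sYS : Y \subset S := subset_trans sYSX (subsetDl _ _).
have sZS : Z \subset S := subset_trans (subsetDl _ _) (subsetDl _ _).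
have cW : #|V :|: Z| = j.
  have /disjoint_setI0 VZ0 : [disjoint V & Z].
    rewrite disjoints_subset; apply/subsetP => x /(subsetP sVX) xX.
    by rewrite !inE xX /= andbF.
  by rewrite cardsU VZ0 cards0; lia.
have sWS : V :|: Z \subset S by rewrite subUset (subset_trans sVX sXS).
have [|X' [Y' [W' [hX hY hW eD]]]] :=
  pad_contribution sSA sXS sYS sWS cX cY cW; first by lia.
exists X', Y', W'; split=> // l; rewrite eD /contribution /indicator !inE.
move: (subsetP sXS l) (subsetP sYSX l) (subsetP sVX l); rewrite inE.
case: (l \in S) (l \in X) (l \in Y) (l \in V) => [] [] [] [] //= H1 H2 H3;
  by [have := H1 isT | have := H2 isT | have := H3 isT].
Qed.

Lemma transfer_contribution (T : finType) (A : {set T}) (x y : T) :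
    x \in A -> y \in A -> x != y ->
  exists X Y W : {set T},
    [/\ half_subset A X, half_subset A Y, half_subset A W &
        forall l, contribution X Y W l = (l == x)%:R - (l == y)%:R].
Proof.
move=> xA yA neq_xy.
have sS : [set x; y] \subset A by apply/subsetP => z /set2P[] ->.
have sx : [set x] \subset [set x; y] by rewrite sub1set set21.
have sy : [set y] \subset [set x; y] by rewrite sub1set set22.
have [|X [Y [W [hX hY hW eD]]]] :=
  pad_contribution sS sx sy sy (cards1 x) (cards1 y) (cards1 y).
  by rewrite cards2 neq_xy.
exists X, Y, W; split=> // l; rewrite eD /contribution /indicator !inE; lia.
Qed.

(** * Treating the supports one by one *)

(** Induction step, with [D] the running sums so far.  The alternative [D l != 0]
    protects the columns of the supports treated earlier. *)
Lemma treat_support (T : finType) (A : {set T}) (D : T -> int) :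
    (2 <= #|A|)%N -> (forall l, -2 <= D l <= 2) ->
  exists X Y W : {set T},
    [/\ half_subset A X, half_subset A Y, half_subset A W &
        forall l, -2 <= D l + contribution X Y W l <= 2 /\
          ((l \in A) || (D l != 0) -> D l + contribution X Y W l != 0)].
Proof.
move=> cA bD; pose S := [set l in A | D l == 0].
have sSA : S \subset A by apply/subsetP => l; rewrite inE => /andP[].
have [/cards1P[x eS]|cS] := boolP (#|S| == 1%N); last first.
  have [X [Y [W [hX hY hW eD]]]] := spread_contribution sSA cS.
  exists X, Y, W; split=> // l.
  have := contribution_bounded X Y W l; have := eD l; have := bD l.
  rewrite inE; case: (l \in A) => /=; lia.
have [xA Dx] : x \in A /\ D x = 0.
  by have := set11 x; rewrite -eS inE => /andP[? /eqP].
have [y /setD1P[neq_yx yA]] : exists y, y \in A :\ x.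
  by apply/set0Pn; rewrite -card_gt0; have := cardsD1 x A; rewrite xA; lia.
have nzA l : l \in A -> l != x -> D l != 0.
  move=> lA; apply: contraNN => Dl.
  by rewrite -in_set1 -eS inE lA.
have Dy := nzA y yA neq_yx.
have neq_xy : x != y by rewrite eq_sym.
(* A step up from [-1] would reach [0], one from [2] would exceed the bound. *)
have [up|down] := boolP ((D y == -2) || (D y == 1)).
- have [X [Y [W [hX hY hW eD]]]] := transfer_contribution yA xA neq_yx.
  exists X, Y, W; split=> // l; rewrite eD; have := bD l; have := nzA l.
  have [->|_] := eqVneq l y; first by rewrite (negbTE neq_yx) yA; lia.
  have [->|_] := eqVneq l x; first by rewrite Dx.
  by case: (l \in A) => /=; lia.
- have [X [Y [W [hX hY hW eD]]]] := transfer_contribution xA yA neq_xy.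
  exists X, Y, W; split=> // l; rewrite eD; have := bD l; have := nzA l.
  have [->|_] := eqVneq l y; first by rewrite (negbTE neq_yx) yA; lia.
  have [->|_] := eqVneq l x; first by rewrite Dx.
  by case: (l \in A) => /=; lia.
Qed.

(** By induction on [s].  As [s] has no repetition, the sets chosen for a new
    support do not alter the earlier running sum. *)
Lemma treat_supports (T I : finType) (A : I -> {set T}) (s : seq I) :
    (forall B, (2 <= #|A B|)%N) -> uniq s ->
  exists X Y W : I -> {set T},
    (forall B, B \in s ->
      [/\ half_subset (A B) (X B), half_subset (A B) (Y B) &
          half_subset (A B) (W B)]) /\
    forall l, let D := \sum_(B <- s) contribution (X B) (Y B) (W B) l in
      -2 <= D <= 2 /\ (forall B, B \in s -> l \in A B -> D != 0).
Proof.
move=> cA; elim: s => [_|C s IHs /= /andP[Cs us]].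
  exists A, A, A; split=> // l /=; by rewrite big_nil.
have {IHs us}[X [Y [W [hXYW hD]]]] := IHs us.
pose D l := \sum_(B <- s) contribution (X B) (Y B) (W B) l.
have [l|XC [YC [WC [hXC hYC hWC hDC]]]] := @treat_support T (A C) D (cA C).
  by case: (hD l).
pose upd (J : I -> {set T}) (JC : {set T}) B := if B == C then JC else J B.
exists (upd X XC), (upd Y YC), (upd W WC); split=> [B|l /=].
  by rewrite inE /upd; case: eqVneq => [-> //|_] /= /hXYW.
have -> : \sum_(B <- C :: s)
    contribution (upd X XC B) (upd Y YC B) (upd W WC B) l
    = D l + contribution XC YC WC l.
  rewrite big_cons addrC /upd eqxx; congr (_ + _).
  apply: eq_big_seq => B Bs.
  by case: eqVneq Bs Cs => // -> ->.
have [bDl nzDl] := hDC l; split=> // B; rewrite inE => BCs lB.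
apply: nzDl; have [eBC|neq_BC] := eqVneq B C; first by rewrite -eBC lB.
rewrite (negbTE neq_BC) /= in BCs.
by have [_ /(_ B BCs lB)] := hD l; rewrite -/(D l) => ->; rewrite orbT.
Qed.

(** * The sum over all columns *)

Lemma sum_indicator (T : finType) (J : {set T}) :
  \sum_(l : T) indicator J l = #|J|%:R.
Proof.
rewrite /indicator -sum1_card natr_sum [RHS]big_mkcond /=.
by apply: eq_bigr => l _; case: (l \in J).
Qed.

Lemma sum_discrepancy (T I : finType) (A J0 J1 Js : I -> {set T}) :
    half_choice A J0 -> half_choice A J1 -> half_choice A Js ->
  \sum_(l : T) discrepancy J0 J1 Js l = 0.
Proof.
move=> h0 h1 hs; rewrite exchange_big big1 // => B _.
rewrite sumrB big_split -mulr_sumr /= !sum_indicator.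
by case: (h0 B) (h1 B) (hs B) => _ -> [_ ->] [_ ->]; lia.
Qed.

Theorem theorem3p1 :
  (forall (Omega I : finType) (A : I -> {set Omega}),
     support_family A ->
     exists J0 J1 Js : I -> {set Omega},
       [/\ half_choice A J0, half_choice A J1, half_choice A Js &
           forall l : Omega,
             discrepancy J0 J1 Js l \in [:: -2; -1; 1; 2]]) /\
  (exists (Omega I : finType) (A : I -> {set Omega}),
     support_family A /\
     ~ (exists J0 J1 Js : I -> {set Omega},
          [/\ half_choice A J0, half_choice A J1, half_choice A Js &
              forall l : Omega,
                discrepancy J0 J1 Js l \in [:: -1; 1]])).
Proof.
split.
  move=> Omega I A [cA coverA].
  have [X [Y [W [hXYW hD]]]] := treat_supports cA (index_enum_uniq I).
  exists X, Y, W; split=> [B|B|B|l]; try by case: (hXYW B (mem_index_enum B)).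
  have [B lB] := coverA l.
  have bD : -2 <= discrepancy X Y W l <= 2 := (hD l).1.
  have nzD : discrepancy X Y W l != 0 := (hD l).2 B (mem_index_enum B) lB.
  by rewrite !inE; lia.
exists 'I_3, unit, (fun=> [set: 'I_3]); split.
  by split=> [_|l]; [rewrite cardsT card_ord | exists tt; rewrite inE].
move=> [J0 [J1 [Js [h0 h1 hs D1]]]].
have pm1 l : discrepancy J0 J1 Js l = -1 \/ discrepancy J0 J1 Js l = 1.
  by have := D1 l; rewrite !inE => /orP[] /eqP ->; [left | right].
have := sum_discrepancy h0 h1 hs; rewrite !big_ord_recl big_ord0.
by case: (pm1 ord0) (pm1 (lift ord0 ord0))
  (pm1 (lift ord0 (lift ord0 ord0))) => -> [] -> [] ->.
Qed.
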